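(* Let $\mathcal{T}$ be a first-order theory and $\varphi_{\mathcal{T}}(\overline{x},\overline{y})$ an $\mathrm{LTL}_{\mathcal{T}}$ specification with literals $l_1,\dots,l_n$. Let $R$ be a feasible set of reactions and let $\varphi_{\mathbb{B}}=\varphi_{\mathcal{T}}[l_i\leftarrow s_i]\wedge\varphi^{extra}(R)$ be the Booleanization of $\varphi_{\mathcal{T}}$ using $R$. Then $\varphi_{\mathcal{T}}$ and $\varphi_{\mathbb{B}}$ are equi-realizable.
   Context: $\mathrm{LTL}_{\mathcal{T}}$ is LTL where atomic propositions are replaced by literals of $\mathcal{T}$; the variables $\overline{x}$ are controlled by the environment and $\overline{y}$ by the system. In the synthesis game the environment picks a valuation of $\overline{x}$ (resp. of the environment propositions) and the system responds with a valuation of $\overline{y}$ (resp. system propositions); a specification is realizable if the system has a strategy (finite-state controller) all of whose plays satisfy it. Two specifications are equi-realizable if both or neither are realizable. Fresh system propositions $s_1,\dots,s_n$ ($s_i$ for $l_i$). A choice is $c\subseteq\{s_1,\dots,s_n\}$ with $f_c(\overline{x},\overline{y})=\bigwedge_{s_i\in c}l_i\wedge\bigwedge_{s_i\notin c}\neg l_i$. A reaction is a set $r$ of choices with $f_r(\overline{x})=\bigwedge_{c\in r}\exists\overline{y}.f_c\wedge\bigwedge_{c\notin r}\forall\overline{y}.\neg f_c$; $r$ is valid if $\exists\overline{x}.f_r(\overline{x})$ is valid in $\mathcal{T}$; $\mathit{VR}$ is the set of valid reactions. The set of minimal valid reactions is $\mathit{MVR}=\{r\in\mathit{VR}\mid\text{there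 is no }r'\in\mathit{VR}\text{ with }r'\subsetneq r\}$. A set $R$ of reactions is feasible if $\mathit{MVR}\subseteq R\subseteq\mathit{VR}$. The Booleanization using $R$ introduces a fresh environment proposition $e_r$ for each $r\in R$, and $\varphi^{extra}(R)$ is $\square(\varphi^{legal}\rightarrow\bigwedge_{r\in R}(e_r\rightarrow\bigvee_{c\in r}(\bigwedge_{s_i\in c}s_i\wedge\bigwedge_{s_i\notin c}\neg s_i)))$, where $\varphi^{legal}$ states that exactly one of the $e_r$ is true.
   Formalization: Realizability is taken in a given model of the theory, and the theory is assumed to decide each sentence ''there is x with f_r(x)'' (automatic for complete theories or a fixed interpretation); without this the claim fails, e.g. for the empty theory and a 0-ary predicate P with specification P. *)

(* Defs.v *)
From HB Require Import structures.
From mathcomp Require Import all_boot.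
From mathcomp Require Import boolp.

Set Implicit Arguments.
Unset Strict Implicit.
Unset Printing Implicit Defensive.

(** * First-order logic with equality *)

(* Constants are function symbols of arity 0. *)
Record signature := Signature {
  fsym : Type;
  farity : fsym -> nat;
  psym : Type;
  parity : psym -> nat
}.

Inductive term (Sg : signature) (V : Type) : Type :=
| TVar of V
| TApp (f : fsym Sg) of ('I_(farity f) -> term Sg V).

Inductive atom (Sg : signature) (V : Type) : Type :=
| AEq of term Sg V & term Sg V
| APred (P : psym Sg) of ('I_(parity P) -> term Sg V).

Inductive literal (Sg : signature) (V : Type) : Type :=
| LitPos of atom Sg V
| LitNeg of atom Sg V.

(* Syntactic equality of literals, decided classically. *)
HB.instance Definition _ (Sg : signature) (V : Type) :=
  gen_eqMixin (literal Sg V).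

(* Bound variables are named: [FEx z psi] binds [z : V] in [psi]. *)
Inductive formula (Sg : signature) (V : Type) : Type :=
| FTrue
| FAtom of atom Sg V
| FNot of formula Sg V
| FAnd of formula Sg V & formula Sg V
| FEx of V & formula Sg V
| FAll of V & formula Sg V.

Arguments FTrue {Sg V}.

Definition formula_of_literal (Sg : signature) (V : Type) (a : literal Sg V) :
    formula Sg V :=
  match a with
  | LitPos b => FAtom b
  | LitNeg b => FNot (FAtom b)
  end.

Record structure (Sg : signature) := Structure {
  domain :> Type;
  point : domain;  (* domains are nonempty *)
  finterp : forall f : fsym Sg, ('I_(farity f) -> domain) -> domain;
  pinterp : forall P : psym Sg, ('I_(parity P) -> domain) -> Prop
}.

Arguments finterp {Sg} s f.
Arguments pinterp {Sg} s P.

Section Semantics.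
Variables (Sg : signature) (M : structure Sg).

Fixpoint eval_term (V : Type) (v : V -> M) (t : term Sg V) : M :=
  match t with
  | TVar z => v z
  | TApp f args => finterp M f (fun k => eval_term v (args k))
  end.

Definition holds_atom (V : Type) (v : V -> M) (a : atom Sg V) : Prop :=
  match a with
  | AEq t u => eval_term v t = eval_term v u
  | APred P args => pinterp M P (fun k => eval_term v (args k))
  end.

Definition holds_literal (V : Type) (v : V -> M) (a : literal Sg V) : Prop :=
  match a with
  | LitPos b => holds_atom v b
  | LitNeg b => ~ holds_atom v b
  end.

Definition update (V : eqType) (v : V -> M) (z : V) (d : M) : V -> M :=
  fun z' => if z' == z then d else v z'.

Fixpoint holds (V : eqType) (v : V -> M) (psi : formula Sg V) : Prop :=
  match psi with
  | FTrue => True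
  | FAtom a => holds_atom v a
  | FNot psi1 => ~ holds v psi1
  | FAnd psi1 psi2 => holds v psi1 /\ holds v psi2
  | FEx z psi1 => exists d : M, holds (update v z d) psi1
  | FAll z psi1 => forall d : M, holds (update v z d) psi1
  end.

End Semantics.

(* A theory is given by its axioms, over variables named by [nat]; free
   variables of an axiom are read as universally quantified. *)
Definition theory (Sg : signature) := formula Sg nat -> Prop.

Definition model (Sg : signature) (T : theory Sg) (M : structure Sg) : Prop :=
  forall psi : formula Sg nat, T psi -> forall v : nat -> M, holds v psi.

Definition valid (Sg : signature) (T : theory Sg) (V : eqType)
    (psi : formula Sg V) : Prop :=
  forall M : structure Sg, model T M -> forall v : V -> M, holds v psi.

Definition decides (Sg : signature) (T : theory Sg) (V : eqType)
    (psi : formula Sg V) : Prop :=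
  valid T psi \/ valid T (FNot psi).

Definition exs (Sg : signature) (V : Type) (zs : seq V) (psi : formula Sg V) :
    formula Sg V :=
  foldr (@FEx Sg V) psi zs.

Definition alls (Sg : signature) (V : Type) (zs : seq V) (psi : formula Sg V) :
    formula Sg V :=
  foldr (@FAll Sg V) psi zs.

(** * Linear temporal logic over an arbitrary type of atoms *)

Inductive ltl (A : Type) : Type :=
| LTrue
| LAtom of A
| LNot of ltl A
| LAnd of ltl A & ltl A
| LNext of ltl A
| LUntil of ltl A & ltl A.

Arguments LTrue {A}.

Definition LFalse {A : Type} : ltl A := LNot LTrue.
Definition LOr (A : Type) (f g : ltl A) : ltl A := LNot (LAnd (LNot f) (LNot g)).
Definition LImp (A : Type) (f g : ltl A) : ltl A := LNot (LAnd f (LNot g)).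
Definition LAlways (A : Type) (f : ltl A) : ltl A := LNot (LUntil LTrue (LNot f)).

Fixpoint ltl_atoms (A : Type) (f : ltl A) : seq A :=
  match f with
  | LTrue => [::]
  | LAtom a => [:: a]
  | LNot f1 => ltl_atoms f1
  | LAnd f1 f2 => ltl_atoms f1 ++ ltl_atoms f2
  | LNext f1 => ltl_atoms f1
  | LUntil f1 f2 => ltl_atoms f1 ++ ltl_atoms f2
  end.

Fixpoint ltl_subst (A B : Type) (s : A -> ltl B) (f : ltl A) : ltl B :=
  match f with
  | LTrue => LTrue
  | LAtom a => s a
  | LNot f1 => LNot (ltl_subst s f1)
  | LAnd f1 f2 => LAnd (ltl_subst s f1) (ltl_subst s f2)
  | LNext f1 => LNext (ltl_subst s f1)
  | LUntil f1 f2 => LUntil (ltl_subst s f1) (ltl_subst s f2)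
  end.

(* [h x a]: the atom [a] is true of the letter [x]. *)
Fixpoint ltl_sat (A X : Type) (h : X -> A -> Prop) (w : nat -> X) (i : nat)
    (f : ltl A) : Prop :=
  match f with
  | LTrue => True
  | LAtom a => h (w i) a
  | LNot f1 => ~ ltl_sat h w i f1
  | LAnd f1 f2 => ltl_sat h w i f1 /\ ltl_sat h w i f2
  | LNext f1 => ltl_sat h w i.+1 f1
  | LUntil f1 f2 => exists2 j, i <= j &
      ltl_sat h w j f2 /\ forall k, i <= k < j -> ltl_sat h w k f1
  end.

(** * Synthesis games *)

(* Mealy machines: the environment moves first in each round.  The memory is
   finite, whereas the alphabets [I] and [O] may be infinite. *)
Record controller (I O : Type) := Controller {
  memory : finType;
  init : memory;
  next : memory -> I -> memory;
  output : memory -> I -> O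
}.

Fixpoint memory_at (I O : Type) (C : controller I O) (inp : nat -> I) (k : nat) :
    memory C :=
  if k is k'.+1 then next (memory_at C inp k') (inp k') else init C.

Definition play (I O : Type) (C : controller I O) (inp : nat -> I) (k : nat) :
    I * O :=
  (inp k, output (memory_at C inp k) (inp k)).

Definition realizable (A I O : Type) (h : I * O -> A -> Prop) (f : ltl A) : Prop :=
  exists C : controller I O, forall inp : nat -> I, ltl_sat h (play C inp) 0 f.

(** * Specifications modulo a theory *)

(* The variables x_0, ..., x_(p-1) are [inl k] and y_0, ..., y_(q-1) are
   [inr k]. *)
Definition var (p q : nat) : finType := ('I_p + 'I_q)%type.

Definition xvars (p q : nat) : seq (var p q) := [seq inl k | k <- enum 'I_p].
Definition yvars (p q : nat) : seq (var p q) := [seq inr k | k <- enum 'I_q].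

Definition valuation (D : Type) (p q : nat)
    (xy : {ffun 'I_p -> D} * {ffun 'I_q -> D}) : var p q -> D :=
  fun z => match z with inl k => xy.1 k | inr k => xy.2 k end.

Definition realizable_mod (Sg : signature) (M : structure Sg) (p q : nat)
    (phi : ltl (literal Sg (var p q))) : Prop :=
  @realizable _ {ffun 'I_p -> M} {ffun 'I_q -> M}
    (fun xy a => holds_literal (valuation xy) a) phi.

(** * Choices and reactions *)

(* The system proposition s_i is represented by its index [i : 'I_n]. *)
Definition choice (n : nat) : finType := {set 'I_n}.
Definition reaction (n : nat) : finType := {set choice n}.

Section Reactions.
Variables (Sg : signature) (T : theory Sg) (p q n : nat).
Variable l : n.-tuple (literal Sg (var p q)).

Definition choice_formula (c : choice n) : formula Sg (var p q) :=
  FAnd (\big[@FAnd _ _/FTrue]_(i : 'I_n | i \in c) formula_of_literal (tnth l i))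
       (\big[@FAnd _ _/FTrue]_(i : 'I_n | i \notin c)
          FNot (formula_of_literal (tnth l i))).

Definition reaction_formula (r : reaction n) : formula Sg (var p q) :=
  FAnd (\big[@FAnd _ _/FTrue]_(c : choice n | c \in r)
          exs (yvars p q) (choice_formula c))
       (\big[@FAnd _ _/FTrue]_(c : choice n | c \notin r)
          alls (yvars p q) (FNot (choice_formula c))).

(* The sentence "there is x such that f_r(x)". *)
Definition reaction_sentence (r : reaction n) : formula Sg (var p q) :=
  exs (xvars p q) (reaction_formula r).

Definition valid_reaction (r : reaction n) : Prop := valid T (reaction_sentence r).

Definition minimal_valid_reaction (r : reaction n) : Prop :=
  valid_reaction r /\
  ~ exists r' : reaction n, valid_reaction r' /\ r' \proper r.

Definition feasible (R : {set reaction n}) : Prop :=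
  (forall r, minimal_valid_reaction r -> r \in R) /\
  (forall r, r \in R -> valid_reaction r).

End Reactions.

(** * Booleanization *)

Section Booleanization.
Variables (n : nat) (R : {set reaction n}).

Definition env_prop : finType := {r : reaction n | r \in R}.

Inductive bprop : Type :=
| PropE of env_prop
| PropS of 'I_n.

Definition holds_bprop (es : {ffun env_prop -> bool} * {ffun 'I_n -> bool})
    (b : bprop) : Prop :=
  match b with
  | PropE e => es.1 e
  | PropS i => es.2 i
  end.

Definition realizable_bool (f : ltl bprop) : Prop := realizable holds_bprop f.

Definition phi_legal : ltl bprop :=
  \big[@LOr _/LFalse]_(e : env_prop)
    LAnd (LAtom (PropE e))
         (\big[@LAnd _/LTrue]_(e' : env_prop | e' != e) LNot (LAtom (PropE e'))).

Definition choice_ltl (c : choice n) : ltl bprop :=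
  LAnd (\big[@LAnd _/LTrue]_(i : 'I_n | i \in c) LAtom (PropS i))
       (\big[@LAnd _/LTrue]_(i : 'I_n | i \notin c) LNot (LAtom (PropS i))).

Definition phi_extra : ltl bprop :=
  LAlways (LImp phi_legal
    (\big[@LAnd _/LTrue]_(e : env_prop)
       LImp (LAtom (PropE e))
            (\big[@LOr _/LFalse]_(c : choice n | c \in val e) choice_ltl c))).

(* The default [LFalse] is never reached when [l] lists all literals of the
   formula in which the substitution takes place. *)
Definition literal_to_prop (A : eqType) (l : n.-tuple A) (a : A) : ltl bprop :=
  if [pick i : 'I_n | tnth l i == a] is Some i then LAtom (PropS i) else LFalse.

Definition booleanization (A : eqType) (l : n.-tuple A) (phi : ltl A) : ltl bprop :=
  LAnd (ltl_subst (literal_to_prop l) phi) phi_extra.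

End Booleanization.

(* Main.v *)
Require Import Defs.
From HB Require Import structures.
From mathcomp Require Import all_boot.
From mathcomp Require Import boolp.

(** In the model [M], every valuation [x] of the environment determines the set
    of choices the system can still achieve, which is the unique reaction [r]
    with [f_r(x)].  Since the theory decides the sentences [exists x, f_r(x)],
    the valid reactions are exactly those determined by some [x].  A controller
    for either game thus simulates one for the other with the same memory: an
    environment proposition [e_r] is translated to an [x] whose reaction is
    [r], and a valuation [x] to [e_r] for a minimal valid reaction [r] included
    in the reaction of [x], so that any choice of [r] can be achieved. *)

Set Implicit Arguments.
Unset Strict Implicit.
Unset Printing Implicit Defensive.

(** * Quantifier blocks and finite conjunctions in first-order logic *)

Section FormulaSemantics.
Variables (Sg : signature) (M : structure Sg) (V : eqType).
Implicit Types (v w : V -> M) (psi : formula Sg V) (zs : seq V).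

Lemma holds_exs v zs psi :
  holds v (exs zs psi) <->
  exists2 w, (forall z, z \notin zs -> w z = v z) & holds w psi.
Proof.
elim: zs v => [|z zs IH] v /=.
  split=> [vpsi|[w wv]]; first by exists v.
  by have -> : w = v by apply/funext => z; exact: wv.
split=> [[d /IH[w wv wpsi]]|[w wv wpsi]].
  exists w => // z'; rewrite inE negb_or => /andP[z'z z'zs].
  by rewrite wv // /update (negbTE z'z).
(* With [w z] as the value of the outermost variable, the remaining block only has to change the
   variables in [zs], even if [z] occurs there again. *)
exists (w z); apply/IH; exists w => // z' z'zs; rewrite /update.
by case: eqVneq => [->//|z'z]; rewrite wv // inE negb_or z'z.
Qed.

Lemma holds_alls_not v zs psi :
  holds v (alls zs (FNot psi)) <-> ~ holds v (exs zs psi).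
Proof.
elim: zs v => [|z zs IH] v //=; split.
  by move=> all_not [d]; exact/IH.
by move=> not_ex d; apply/IH => ?; apply: not_ex; exists d.
Qed.

Lemma holds_bigand (I : finType) (P : pred I) (F : I -> formula Sg V) v :
  holds v (\big[@FAnd _ _/FTrue]_(i | P i) F i) <->
  forall i, P i -> holds v (F i).
Proof.
suff H (s : seq I) : holds v (\big[@FAnd _ _/FTrue]_(i <- s | P i) F i) <->
    forall i, i \in s -> P i -> holds v (F i).
  by rewrite H; split=> Fs i; [apply: Fs|move=> _; apply: Fs];
    rewrite ?mem_index_enum.
elim: s => [|j s IH]; first by rewrite big_nil.
rewrite big_cons; split.
  case: ifPn => [Pj /= [Fj /IH Fs]|nPj /IH Fs] i;
    rewrite inE => /predU1P[->|] //.
  - exact: Fs.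
  - by rewrite (negbTE nPj).
  - exact: Fs.
move=> Fs; have Fs' : forall i, i \in s -> P i -> holds v (F i).
  by move=> i si; apply: Fs; rewrite inE si orbT.
case: ifP => [Pj|_] /=; rewrite IH //; split=> //.
by apply: Fs; rewrite ?mem_head.
Qed.

Lemma holds_formula_of_literal v (a : literal Sg V) :
  holds v (formula_of_literal a) <-> holds_literal v a.
Proof. by case: a. Qed.

End FormulaSemantics.

(** * Derived connectives and substitution in LTL *)

Section LtlSemantics.
Variables (A X : Type) (h : X -> A -> Prop) (w : nat -> X) (k : nat).
Implicit Types f g : ltl A.

Lemma ltl_sat_or f g :
  ltl_sat h w k (LOr f g) <-> ltl_sat h w k f \/ ltl_sat h w k g.
Proof.
split=> /= [|[?|?] []//].
by move/not_andP => [/contrapT|/contrapT]; [left|right].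
Qed.

Lemma ltl_sat_imp f g :
  ltl_sat h w k (LImp f g) <-> (ltl_sat h w k f -> ltl_sat h w k g).
Proof.
split=> /= [nfg sf|fg [/fg]//].
by apply: contrapT => ng; exact: nfg.
Qed.

Lemma ltl_sat_always f :
  ltl_sat h w k (LAlways f) <-> forall j, k <= j -> ltl_sat h w j f.
Proof.
split=> /= [nex j kj|sf [j kj [nf _]]]; last exact: nf (sf _ kj).
by apply: contrapT => nf; apply: nex; exists j.
Qed.

Lemma ltl_sat_bigand (I : finType) (P : pred I) (F : I -> ltl A) :
  ltl_sat h w k (\big[@LAnd _/LTrue]_(i | P i) F i) <->
  forall i, P i -> ltl_sat h w k (F i).
Proof.
suff H (s : seq I) : ltl_sat h w k (\big[@LAnd _/LTrue]_(i <- s | P i) F i) <->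
    forall i, i \in s -> P i -> ltl_sat h w k (F i).
  by rewrite H; split=> Fs i; [apply: Fs|move=> _; apply: Fs];
    rewrite ?mem_index_enum.
elim: s => [|j s IH]; first by rewrite big_nil.
rewrite big_cons; split.
  case: ifPn => [Pj /= [Fj /IH Fs]|nPj /IH Fs] i;
    rewrite inE => /predU1P[->|] //.
  - exact: Fs.
  - by rewrite (negbTE nPj).
  - exact: Fs.
move=> Fs; have Fs' : forall i, i \in s -> P i -> ltl_sat h w k (F i).
  by move=> i si; apply: Fs; rewrite inE si orbT.
case: ifP => [Pj|_] /=; rewrite IH //; split=> //.
by apply: Fs; rewrite ?mem_head.
Qed.

Lemma ltl_sat_bigor (I : finType) (P : pred I) (F : I -> ltl A) :
  ltl_sat h w k (\big[@LOr _/LFalse]_(i | P i) F i) <->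
  exists2 i, P i & ltl_sat h w k (F i).
Proof.
suff H (s : seq I) : ltl_sat h w k (\big[@LOr _/LFalse]_(i <- s | P i) F i) <->
    exists2 i, i \in s & P i /\ ltl_sat h w k (F i).
  rewrite H; split=> [[i _ [Pi Fi]]|[i Pi Fi]]; exists i => //.
elim: s => [|j s IH]; first by rewrite big_nil; split=> [|[]] //=; case.
rewrite big_cons; split.
  case: ifPn => [Pj /ltl_sat_or[Fj|/IH[i si Fi]]|_ /IH[i si Fi]].
  - by exists j; rewrite ?mem_head.
  - by exists i; rewrite // inE si orbT.
  - by exists i; rewrite // inE si orbT.
case=> i; rewrite inE => /predU1P[->|si] [Pi Fi].
  by rewrite Pi; apply/ltl_sat_or; left.
by case: ifP => _; [apply/ltl_sat_or; right|]; apply/IH; exists i.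
Qed.

End LtlSemantics.

(** Induction on [f]. The agreement on atoms is assumed at every position because the temporal
    operators move the position. *)
Lemma ltl_sat_subst (A : eqType) (B X Y : Type) (h : X -> A -> Prop)
    (g : Y -> B -> Prop) (w : nat -> X) (u : nat -> Y) (s : A -> ltl B)
    (f : ltl A) :
  (forall k a, a \in ltl_atoms f -> h (w k) a <-> ltl_sat g u k (s a)) ->
  forall k, ltl_sat h w k f <-> ltl_sat g u k (ltl_subst s f).
Proof.
elim: f => [|a|f IH|f IHf f' IHf'|f IH|f IHf f' IHf'] /= hs k //.
- by apply: hs; rewrite inE.
- by rewrite IH.
- by rewrite IHf ?IHf' // => j a fa; apply: hs; rewrite mem_cat fa ?orbT.
- exact: IH.
- have {}IHf : forall k, ltl_sat h w k f <-> ltl_sat g u k (ltl_subst s f).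
    by apply: IHf => j a fa; apply: hs; rewrite mem_cat fa.
  have {}IHf' : forall k, ltl_sat h w k f' <-> ltl_sat g u k (ltl_subst s f').
    by apply: IHf' => j a fa; apply: hs; rewrite mem_cat fa orbT.
  by split=> -[j kj [/IHf' f'j fk]]; exists j => //; split=> // i /fk /IHf.
Qed.

(** * Choices and reactions in a fixed model *)

Section ReactionSemantics.
Variables (Sg : signature) (M : structure Sg) (p q n : nat).
Variable l : n.-tuple (literal Sg (var p q)).
Implicit Types (v : var p q -> M) (x : {ffun 'I_p -> M}) (y : {ffun 'I_q -> M}).
Implicit Types (c : Defs.choice n) (r : reaction n).

Definition choice_of x y : Defs.choice n :=
  [set i | `[< holds_literal (valuation (x, y)) (tnth l i) >]].

Definition reaction_of x : reaction n :=
  [set c | `[< exists y, choice_of x y = c >]].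

Lemma choice_ofP x y i :
  i \in choice_of x y <-> holds_literal (valuation (x, y)) (tnth l i).
Proof. by rewrite inE; split=> /asboolP. Qed.

Lemma reaction_ofP x c : c \in reaction_of x <-> exists y, choice_of x y = c.
Proof. by rewrite inE; split=> /asboolP. Qed.

Definition xpart v : {ffun 'I_p -> M} := [ffun k => v (inl k)].
Definition ypart v : {ffun 'I_q -> M} := [ffun k => v (inr k)].

Lemma valuation_parts v : valuation (xpart v, ypart v) = v.
Proof. by apply/funext => -[k|k] /=; rewrite ffunE. Qed.

(** The two conjunctions settle the membership of every index, so they leave one choice only. *)
Lemma holds_choice_formula v c :
  holds v (choice_formula l c) <-> choice_of (xpart v) (ypart v) = c.
Proof.
rewrite /choice_formula /= !holds_bigand; split.
  case=> pos neg; apply/setP => i; apply/idP/idP => [|ci].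
    rewrite choice_ofP valuation_parts -holds_formula_of_literal => li.
    by apply: contraT => /neg; case.
  apply/choice_ofP; rewrite valuation_parts -holds_formula_of_literal.
  exact: pos.
move=> <-; split=> i; last move=> /negP.
all: rewrite choice_ofP valuation_parts -holds_formula_of_literal //.
Qed.

Lemma holds_exs_choice_formula v c :
  holds v (exs (yvars p q) (choice_formula l c)) <->
  c \in reaction_of (xpart v).
Proof.
rewrite holds_exs reaction_ofP; split=> [[w wv /holds_choice_formula wc]|[y yc]].
  exists (ypart w); rewrite -wc; congr (choice_of _ _).
  (* No [inl k] lies in [yvars], so [w] keeps the environment part of [v]. *)
  by apply/ffunP => k; rewrite !ffunE wv //; apply/mapP => -[].
exists (valuation (xpart v, y)).
  case=> k /=; first by rewrite ffunE.
  by rewrite map_f ?mem_enum.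
apply/holds_choice_formula; rewrite -yc; congr (choice_of _ _).
  by apply/ffunP => k; rewrite !ffunE /= ffunE.
by apply/ffunP => k; rewrite !ffunE.
Qed.

Lemma holds_reaction_formula v r :
  holds v (reaction_formula l r) <-> reaction_of (xpart v) = r.
Proof.
rewrite /reaction_formula /= !holds_bigand; split.
  case=> pos neg; apply/setP => c; apply/idP/idP => [|rc].
    move/holds_exs_choice_formula => vc; apply: contraT => /neg.
    by rewrite holds_alls_not.
  by apply/holds_exs_choice_formula; exact: pos.
move=> <-; split=> c; first by rewrite holds_exs_choice_formula.
by move=> /negP; rewrite holds_alls_not holds_exs_choice_formula.
Qed.

Lemma holds_reaction_sentence v r :
  holds v (reaction_sentence l r) <-> exists x, reaction_of x = r.
Proof.
rewrite /reaction_sentence holds_exs; split.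
  by case=> w _ /holds_reaction_formula; exists (xpart w).
case=> x xr; exists (valuation (x, ypart v)).
  case=> k /=; first by rewrite map_f ?mem_enum.
  by rewrite ffunE.
apply/holds_reaction_formula; rewrite -xr; congr reaction_of.
by apply/ffunP => k; rewrite !ffunE.
Qed.

Variable T : theory Sg.
Hypothesis TM : model T M.

(** Validity speaks of all models, the right-hand side of [M] alone. Decidability bridges the gap: a
    sentence true in [M] cannot be refuted by the theory. *)
Lemma valid_reactionP r :
  decides T (reaction_sentence l r) ->
  valid_reaction T l r <-> exists x, reaction_of x = r.
Proof.
pose v0 : var p q -> M := fun=> point M.
move=> dec; split=> [/(_ M TM v0)/holds_reaction_sentence //|xr].
case: dec => // /(_ M TM v0) /= nr.
by case: nr; apply/holds_reaction_sentence.
Qed.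

(** There are finitely many reactions, so a minimal valid one lies below [r], and feasibility puts
    it in [R]. *)
Lemma feasible_below R r :
  feasible T l R -> valid_reaction T l r -> exists2 r', r' \in R & r' \subset r.
Proof.
move=> [minR _] /asboolP vr.
have [r' /minsetP[/asboolP vr' min_r'] r'r] :=
  minset_exists (P := fun r => `[< valid_reaction T l r >]) vr.
exists r' => //; apply: minR; split=> // -[s [/asboolP vs /andP[sr' nr's]]].
by move: nr's; rewrite (min_r' s vs sr') subxx.
Qed.

End ReactionSemantics.

(** * Meaning of the Booleanized constraints *)

Section BooleanSemantics.
Variables (n : nat) (R : {set reaction n}).
Variable u : nat -> {ffun env_prop R -> bool} * {ffun 'I_n -> bool}.
Let sat k f := ltl_sat (@holds_bprop n R) u k f.

(** These are exactly the environment letters that satisfy [phi_legal]. *)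
Definition only (e : env_prop R) : {ffun env_prop R -> bool} :=
  [ffun e' => e' == e].

Lemma sat_phi_legal k : sat k (phi_legal R) <-> exists e, (u k).1 = only e.
Proof.
rewrite /sat /phi_legal ltl_sat_bigor; split=> [[e _ /= [ke]]|[e ke]].
  move=> /ltl_sat_bigand nke; exists e; apply/ffunP => e'; rewrite ffunE.
  by have [->|/nke /= /negP/negbTE] := eqVneq e' e.
exists e => //=; rewrite ke ffunE eqxx; split=> //.
by apply/ltl_sat_bigand => e' /= e'e; rewrite ke ffunE (negbTE e'e).
Qed.

Lemma sat_choice_ltl k (c : Defs.choice n) :
  sat k (choice_ltl R c) <-> [set i | (u k).2 i] = c.
Proof.
rewrite /sat /choice_ltl /= !ltl_sat_bigand /=; split.
  case=> pos neg; apply/setP => i; rewrite inE.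
  by case: (boolP (i \in c)) => [/pos|/neg/negP/negbTE].
by move=> <-; split=> i; rewrite inE // => /negP.
Qed.

Lemma sat_phi_extra :
  sat 0 (phi_extra R) <->
  forall k e, (u k).1 = only e -> [set i | (u k).2 i] \in val e.
Proof.
rewrite /sat /phi_extra ltl_sat_always; split=> [H k e ke|H k _].
  have /ltl_sat_imp := H k isT; rewrite -/(sat k _) sat_phi_legal.
  move/(_ (ex_intro _ e ke)) => /ltl_sat_bigand/(_ e isT)/ltl_sat_imp /=.
  rewrite ke ffunE eqxx => /(_ isT)/ltl_sat_bigor[c ce].
  by move/sat_choice_ltl => ->.
apply/ltl_sat_imp => /sat_phi_legal[e ke].
apply/ltl_sat_bigand => e' _; apply/ltl_sat_imp => /=.
rewrite ke ffunE => /eqP ->; apply/ltl_sat_bigor.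
by exists [set i | (u k).2 i]; [exact: H|exact/sat_choice_ltl].
Qed.

Lemma sat_literal_to_prop (A : eqType) (l : n.-tuple A) (P : A -> Prop) k a :
  (forall i, (u k).2 i <-> P (tnth l i)) ->
  a \in l -> P a <-> sat k (literal_to_prop R l a).
Proof.
move=> uP /tnthP[j ->]; rewrite /literal_to_prop.
(* Whichever index is picked carries the same literal; the index [j] excludes the default case. *)
case: pickP => [i /eqP <-|/(_ j)]; last by rewrite eqxx.
by rewrite -uP.
Qed.

End BooleanSemantics.

(** * Translating controllers between the two games *)

Section EquiRealizability.
Variables (Sg : signature) (M : structure Sg) (p q n : nat).
Variables (phi : ltl (literal Sg (var p q))).
Variable l : n.-tuple (literal Sg (var p q)).
Variable R : {set reaction n}.
Hypothesis phi_l : {subset ltl_atoms phi <= l}.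

(** Reduces each simulation to a comparison of choices, position by position. *)
Lemma ltl_sat_booleanization
    (w : nat -> {ffun 'I_p -> M} * {ffun 'I_q -> M})
    (u : nat -> {ffun env_prop R -> bool} * {ffun 'I_n -> bool}) :
  (forall k, [set i | (u k).2 i] = choice_of l (w k).1 (w k).2) ->
  ltl_sat (fun xy a => holds_literal (valuation xy) a) w 0 phi <->
  ltl_sat (@holds_bprop n R) u 0 (ltl_subst (literal_to_prop R l) phi).
Proof.
move=> uw; apply: ltl_sat_subst => k a /phi_l la.
apply: (sat_literal_to_prop (P := holds_literal (valuation (w k)))) => // i.
by case: (w k) (uw k) => x y /= uk; rewrite -choice_ofP -uk inE.
Qed.

Lemma realizable_mod_bool :
  (forall r, r \in R -> exists x : {ffun 'I_p -> M}, reaction_of l x = r) ->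
  realizable_mod M phi -> realizable_bool (booleanization R l phi).
Proof.
move=> realR [C Cphi].
have /choice[X XP] : forall b : {ffun env_prop R -> bool},
    exists x : {ffun 'I_p -> M},
      forall e, b = only e -> reaction_of l x = val e.
  move=> b; have [[e be]|nobe] := pselect (exists e, b = only e); last first.
    (* Any valuation will do for an illegal letter: [phi_extra] demands nothing there, and [C]
       satisfies [phi] on every input. *)
    by exists [ffun=> point M] => e be; case: nobe; exists e.
  have [x xe] := realR _ (valP e); exists x => e'; rewrite be => ee'.
  by have /ffunP/(_ e) := ee'; rewrite !ffunE eqxx => /esym/eqP <-.
(* [D] feeds [C] the translated input and reports the truth values of the literals under the answer
   of [C]. *)
pose D := @Controller {ffun env_prop R -> bool} {ffun 'I_n -> bool} (memory C)
  (init C) (fun m b => Defs.next m (X b))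
  (fun m b => [ffun i => i \in choice_of l (X b) (output m (X b))]).
exists D => inp; pose inpX k := X (inp k).
have memD k : memory_at D inp k = memory_at C inpX k.
  by elim: k => //= k ->.
have simul k : [set i | (play D inp k).2 i] =
    choice_of l (play C inpX k).1 (play C inpX k).2.
  by apply/setP => i; rewrite inE /= ffunE memD.
split; first exact/(ltl_sat_booleanization simul).
apply/sat_phi_extra => k e ke; rewrite simul /=.
(* The reported choice is achieved by the answer of [C], hence belongs to the reaction of the
   translated input. *)
by rewrite -(XP _ _ ke); apply/reaction_ofP; eexists.
Qed.

(** [D] is only fed legal letters, so [phi_extra] confines it to choices of a reaction below that of
    [x], all of which are achievable. *)
Lemma realizable_bool_mod :
  (forall x : {ffun 'I_p -> M},
     exists2 r, r \in R & r \subset reaction_of l x) ->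
  realizable_bool (booleanization R l phi) -> realizable_mod M phi.
Proof.
move=> belowR [D Dphi].
have /choice[E EP] : forall x : {ffun 'I_p -> M},
    exists e : env_prop R, val e \subset reaction_of l x.
  by move=> x; have [r Rr rx] := belowR x; exists (Sub r Rr); rewrite SubK.
have /choice[Y YP] : forall xc : {ffun 'I_p -> M} * Defs.choice n, exists y,
    xc.2 \in reaction_of l xc.1 -> choice_of l xc.1 y = xc.2.
  move=> xc.
  have [/reaction_ofP[y yc]|nxc] := boolP (xc.2 \in reaction_of l xc.1).
    by exists y.
  (* Default for an unachievable choice, which does not arise in the plays below. *)
  by exists [ffun=> point M].
pose C := @Controller {ffun 'I_p -> M} {ffun 'I_q -> M} (memory D)
  (init D) (fun m x => Defs.next m (only (E x)))
  (fun m x => Y (x, [set i | output m (only (E x)) i])).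
exists C => inp; pose inpE k := only (E (inp k)).
have memC k : memory_at C inp k = memory_at D inpE k.
  by elim: k => //= k ->.
have [phiD /sat_phi_extra extraD] := Dphi inpE.
have simul k : [set i | (play D inpE k).2 i] =
    choice_of l (play C inp k).1 (play C inp k).2.
  rewrite /= memC; apply/esym/(YP (_, _)) => /=.
  by apply: (subsetP (EP (inp k))); exact: (extraD k).
exact/(ltl_sat_booleanization simul).
Qed.

End EquiRealizability.

Theorem theorem3 :
  forall (Sg : signature) (T : theory Sg) (M : structure Sg) (p q n : nat)
    (phi : ltl (literal Sg (var p q))) (l : n.-tuple (literal Sg (var p q)))
    (R : {set reaction n}),
    model T M ->
    uniq l ->
    ltl_atoms phi =i l ->
    (forall r : reaction n, decides T (reaction_sentence l r)) ->
    feasible T l R ->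
    realizable_mod M phi <-> realizable_bool (booleanization R l phi).
Proof.
move=> Sg T M p q n phi l R TM _ phi_l dec feasR.
have sub_l : {subset ltl_atoms phi <= l} by move=> a; rewrite phi_l.
split.
  (* Here feasibility enters through the validity of every member of [R]. *)
  apply: realizable_mod_bool => // r Rr.
  by apply/(valid_reactionP TM (dec r)); exact: feasR.2.
(* Here it enters through the minimal valid reactions: the reaction of [x] is valid, so [R] has a
   member below it. *)
apply: realizable_bool_mod => // x; apply: (feasible_below feasR).
by apply/(valid_reactionP TM (dec _)); exists x.
Qed.
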